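(* Let $R$ be an integral domain and let $\ast=\tilde{\ast}$ be a star operation on $R$ that is spectral and of finite type. Let $D:=R^{[\ast]}$ be the $\ast$-integral closure of $R$ and let $\dot\ast$ be the operation induced by $\ast$ on $D$. If $R$ is Clifford $\ast$-regular, then $D$ is a P$\dot{\ast}$MD and $\dot{\ast}=w_D=t_D$. In addition, if $R$ is Boole $\ast$-regular, then $D$ is a GCD-domain.
   Context: $R$ is an integral domain with field of fractions $K$. An ideal of $R$ means a nonzero fractional ideal (an integral ideal if contained in $R$); prime ideals are integral and nonzero. $\mathcal F(R)$ is the set of ideals, and $(J:I)=\{x\in K: xI\subseteq J\}$. A star operation on $R$ is a map $\mathcal F(R)\to\mathcal F(R)$, $I\mapsto I^\ast$, such that for all $0\ne a\in K$ and $I,J\in\mathcal F(R)$: $R^\ast=R$ and $(aI)^\ast=aI^\ast$; $I\subseteq I^\ast$, and $I\subseteq J$ implies $I^\ast\subseteq J^\ast$; $I^{\ast\ast}=I^\ast$. It is of finite type if $I^\ast=\bigcup\{J^\ast: J\subseteq I,\ J \text{ a finitely generated ideal}\}$ for all $I$. $I$ is a $\ast$-ideal if $I=I^\ast$; a $\ast$-maximal ideal is a maximal element of the set of proper integral $\ast$-ideals; $\ast\text{-Max}(R)$ is the set of $\ast$-maximal ideals. For $\ast$ of finite type, $\tilde{\ast}$ is the star operation $I\mapsto\bigcap_{M\in\ast\text{-Max}(R)}IR_M$; one has $\ast=\tilde\ast$ exactly when $\ast$ is spectral (i.e. $I^\ast=\bigcap_{P\in\mathcal G}IR_P$ for some family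 $\mathcal G$ of pairwise incomparable primes with $R=\bigcap_{P\in\mathcal G}R_P$) and of finite type. When $\ast=\tilde\ast$, the same formula $I^\ast=\bigcap_{M\in\ast\text{-Max}(R)}IR_M$ is used for every nonzero $R$-submodule $I$ of $K$. $R$ is Clifford $\ast$-regular if for every ideal $I$ of $R$ there is an ideal $J$ of $R$ with $I^\ast=(I^2J)^\ast$; it is Boole $\ast$-regular if for every ideal $I$ there is $0\neq x\in K$ with $(I^2)^\ast=xI^\ast$. The $\ast$-integral closure of $R$ is the overring $R^{[\ast]}=\bigcup\{(J^\ast:J^\ast): J \text{ a finitely generated ideal of } R\}$. With $D=R^{[\ast]}$ one has $D^\ast=D$, and $\dot\ast$ is the star operation on $D$ given by $I^{\dot\ast}=I^\ast=\bigcap_{M\in\ast\text{-Max}(R)}IR_M$ for ideals $I$ of $D$. On a domain $D$: $I^{v_D}=(D:(D:I))$, $I^{t_D}=\bigcup\{J^{v_D}: J\subseteq I \text{ a finitely generated ideal of }D\}$, $w_D=\widetilde{t_D}$. For a star operation $\star$ of finite type on $D$, $D$ is a P$\star$MD if each finitely generated ideal $I$ of $D$ is $\star$-invertible, i.e. $(I(D:I))^\star=D$. A GCD-domain is a domain in which any two nonzero elements have a greatest common divisor. *)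

(* Defs.v *)
From HB Require Import structures.
From mathcomp Require Import all_boot all_order all_algebra.
From mathcomp Require Import boolp classical_sets.

Set Implicit Arguments.
Unset Strict Implicit.
Unset Printing Implicit Defensive.

Import GRing.Theory.
Local Open Scope classical_set_scope.
Local Open Scope ring_scope.

(* A domain is modelled as a subring [A : set K] of a field [K], so that a
   domain and its overrings are objects of the same kind, and their fractional
   ideals are sets of type [set K].  An operation on ideals is a total function
   [star : set K -> set K]; all conditions on it, and all equalities between
   two of them, are restricted to the fractional ideals of the domain at
   hand. *)
Section Domains.
Variable K : fieldType.
Implicit Types (A I J M N P : set K) (star : set K -> set K).

Definition subring A : Prop :=
  [/\ A 1, forall x y, A x -> A y -> A (x - y)
         & forall x y, A x -> A y -> A (x * y)].

Definition submodule A I : Prop :=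
  [/\ I 0, forall x y, I x -> I y -> I (x + y)
         & forall a x, A a -> I x -> I (a * x)].

Definition ideal A I : Prop :=
  [/\ submodule A I, exists2 x, I x & x != 0
    & exists2 d, A d & d != 0 /\ forall x, I x -> A (d * x)].

Definition integral_ideal A I : Prop := ideal A I /\ I `<=` A.

Definition fg_ideal A I : Prop :=
  ideal A I /\
  exists (n : nat) (g : 'I_n -> K),
    I = [set x | exists c : 'I_n -> K,
                   (forall i, A (c i)) /\ x = \sum_(i < n) c i * g i].

Definition prime_ideal A P : Prop :=
  [/\ integral_ideal A P, P <> A
    & forall x y, A x -> A y -> P (x * y) -> P x \/ P y].

Definition colon J I : set K := [set x | forall y, I y -> J (x * y)].

Definition prod_ideal I J : set K :=
  [set x | exists (n : nat) (f g : 'I_n -> K),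
             [/\ forall i, I (f i), forall i, J (g i)
               & x = \sum_(i < n) f i * g i]].

Definition scale (a : K) I : set K := [set a * x | x in I].

Definition loc A P : set K :=
  [set x | exists a s, [/\ A a, A s, ~ P s & x = a / s]].

Definition star_operation A star : Prop :=
  [/\ forall I, ideal A I -> ideal A (star I),
      star A = A
        /\ forall a I, a != 0 -> ideal A I -> star (scale a I) = scale a (star I),
      forall I, ideal A I -> I `<=` star I,
      forall I J, ideal A I -> ideal A J -> I `<=` J -> star I `<=` star J
    & forall I, ideal A I -> star (star I) = star I].

Definition finite_type_op A star : Prop :=
  forall I, ideal A I ->
    star I = \bigcup_(J in [set J | fg_ideal A J /\ J `<=` I]) star J.

Definition spectral_op A star : Prop :=
  exists G : set (set K),
    [/\ forall P, G P -> prime_ideal A P,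
        forall P Q, G P -> G Q -> P `<=` Q -> P = Q,
        A = \bigcap_(P in G) loc A P
      & forall I, ideal A I ->
          star I = \bigcap_(P in G) prod_ideal I (loc A P)].

Definition proper_star_ideal A star I : Prop :=
  [/\ integral_ideal A I, I <> A & star I = I].

Definition star_max A star : set (set K) :=
  [set M | proper_star_ideal A star M /\
           forall N, proper_star_ideal A star N -> M `<=` N -> N = M].

(* The formula is applied to every subset of [K], hence in particular to the
   fractional ideals of an overring of [A]. *)
Definition star_tilde A star : set K -> set K :=
  fun I => \bigcap_(M in star_max A star) prod_ideal I (loc A M).

Definition eq_on_ideals A star1 star2 : Prop :=
  forall I, ideal A I -> star1 I = star2 I.

Definition clifford_regular A star : Prop :=
  forall I, ideal A I ->
    exists2 J, ideal A J & star I = star (prod_ideal (prod_ideal I I) J).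

Definition boole_regular A star : Prop :=
  forall I, ideal A I ->
    exists2 x : K, x != 0 & star (prod_ideal I I) = scale x (star I).

Definition star_integral_closure A star : set K :=
  \bigcup_(J in [set J | fg_ideal A J]) colon (star J) (star J).

Definition v_op A : set K -> set K := fun I => colon A (colon A I).

Definition t_op A : set K -> set K :=
  fun I => \bigcup_(J in [set J | fg_ideal A J /\ J `<=` I]) v_op A J.

Definition w_op A : set K -> set K := star_tilde A (t_op A).

Definition PstarMD A star : Prop :=
  [/\ subring A, star_operation A star, finite_type_op A star
    & forall I, fg_ideal A I -> star (prod_ideal I (colon A I)) = A].

Definition divides_in A (x y : K) : Prop := exists2 c, A c & y = c * x.

Definition gcd_domain A : Prop :=
  subring A /\
  forall a b, A a -> A b -> a != 0 -> b != 0 ->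
    exists2 g, A g &
      [/\ divides_in A g a, divides_in A g b
        & forall h, A h -> divides_in A h a -> divides_in A h b ->
            divides_in A h g].

End Domains.

Definition base_ring (R : idomainType) : set {fraction R} :=
  range (@tofrac R).
Arguments base_ring R : clear implicits.

(* Main.v *)
(* If [I] is a finitely generated ideal of [R] with [I^* = (I^2 J)^*], then
   [I J] maps [I^*] into itself, so [I J] lies in [D]; and locally at each
   [*]-maximal [M] one has [I = (I J) I], so the determinant trick gives
   [1 \in I J D_M].  Since finitely generated ideals of [D] are of the form
   [I D], they are all invertible for the induced operation, which therefore
   coincides with [v_D] on them and with [t_D] everywhere; [w_D = t_D] because
   the induced operation is defined by localizations.  In the Boole case
   [J = x^-1 R], hence [(I D)^* = x D], and [x] is a gcd of the generators. *)

Require Import Defs.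
From HB Require Import structures.
From mathcomp Require Import all_boot all_order all_algebra.
From mathcomp Require Import boolp classical_sets.

Set Implicit Arguments.
Unset Strict Implicit.
Unset Printing Implicit Defensive.

Import GRing.Theory.
Local Open Scope classical_set_scope.
Local Open Scope ring_scope.

(** * Submodules of a field, spans and products *)

Section Modules.
Variable K : fieldType.
Implicit Types (A B D I J M N S T : set K).

(** The coefficients range over an arbitrary set, so that combinations with coefficients in an ideal
    are covered, as the determinant trick requires. Any finite index type is allowed, so that
    products are indexed by pairs. *)
Definition span S (X : finType) (g : X -> K) : set K :=
  [set x | exists c : X -> K, (forall i, S (c i)) /\ x = \sum_i c i * g i].

(** For a submodule [S] and a prime [M] this is the localization of [S] at [M], written with one
    denominator instead of a finite sum. Denominators stay in [A] even when [S] is a module over an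
    overring. *)
Definition at_loc A M S : set K :=
  [set x | exists s, [/\ A s, ~ M s & S (s * x)]].

(** The ideal of denominators of [x] relative to [I]: [x] lies in [I] locally at [M] exactly when
    this ideal is not contained in [M]. *)
Definition principal_conductor A I (x : K) : set K :=
  [set s | A s /\ I (s * x)].

Definition has_fractions A : Prop :=
  forall x : K, exists a s, [/\ A a, A s, s != 0 & x = a / s].

Lemma subring1 A : subring A -> A 1.
Proof. by case. Qed.

Lemma subringM A x y : subring A -> A x -> A y -> A (x * y).
Proof. by case=> _ _; apply. Qed.

Lemma subring0 A : subring A -> A 0.
Proof. by case=> A1 AB _; rewrite -(subrr 1); apply: AB. Qed.

Lemma subringN A x : subring A -> A x -> A (- x).
Proof.
move=> rA Ax; have A0 := subring0 rA; case: rA => _ AB _.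
by rewrite -sub0r; apply: AB.
Qed.

Lemma subringD A x y : subring A -> A x -> A y -> A (x + y).
Proof.
move=> rA Ax Ay; rewrite -(opprK y); have Ny := subringN rA Ay.
by case: rA => _ AB _; apply: AB.
Qed.

Lemma subring_submodule A : subring A -> submodule A A.
Proof.
move=> rA; split; first exact: subring0.
- by move=> x y; apply: subringD.
- by move=> x y; apply: subringM.
Qed.

Lemma submodule0 A S : submodule A S -> S 0.
Proof. by case. Qed.

Lemma submoduleD A S x y : submodule A S -> S x -> S y -> S (x + y).
Proof. by case=> _ SD _; apply: SD. Qed.

Lemma submoduleZ A S a x : submodule A S -> A a -> S x -> S (a * x).
Proof. by case=> _ _ SZ; apply: SZ. Qed.

Lemma submoduleW A D S : A `<=` D -> submodule D S -> submodule A S.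
Proof. by move=> AD [S0 SD SZ]; split=> // a x /AD; apply: SZ. Qed.

Lemma submodule_sum A S (X : finType) (f : X -> K) :
  submodule A S -> (forall i, S (f i)) -> S (\sum_i f i).
Proof.
move=> [S0 SD _] Sf; elim/big_rec: _ => // i x _ Sx; exact: SD.
Qed.

Lemma prod_idealP I J x y : I x -> J y -> prod_ideal I J (x * y).
Proof.
move=> Ix Jy; exists 1, (fun=> x), (fun=> y); split=> //.
by rewrite big_ord1.
Qed.

Lemma prod_ideal_min A I J S : submodule A S ->
  (forall x y, I x -> J y -> S (x * y)) -> prod_ideal I J `<=` S.
Proof.
move=> mS IJS _ [n [f [g [If Jg ->]]]]; apply: (submodule_sum mS) => i.
exact: IJS.
Qed.

Lemma prod_idealS I I' J J' : I `<=` I' -> J `<=` J' ->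
  prod_ideal I J `<=` prod_ideal I' J'.
Proof.
move=> II' JJ' _ [n [f [g [If Jg ->]]]]; exists n, f, g.
by split=> // i; [apply/II'/If | apply/JJ'/Jg].
Qed.

Lemma prod_idealC I J : prod_ideal I J = prod_ideal J I.
Proof.
apply/seteqP; split=> _ [n [f [g [If Jg ->]]]]; exists n, g, f; split=> //;
  by apply: eq_bigr => i _; rewrite mulrC.
Qed.

Lemma prod_ideal_submodule A I J :
  (forall a x, A a -> I x -> I (a * x)) -> submodule A (prod_ideal I J).
Proof.
move=> IZ; split.
- by exists 0, (fun=> 0), (fun=> 0); rewrite big_ord0; split=> // -[].
- move=> _ _ [m [f [g [If Jg ->]]]] [n [f' [g' [If' Jg' ->]]]].
  pose pick (h : 'I_m -> K) (h' : 'I_n -> K) (k : 'I_(m + n)) :=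
    match split k with inl i => h i | inr j => h' j end.
  exists (m + n)%N, (pick f f'), (pick g g'); split.
  + by move=> k; rewrite /pick; case: (split k).
  + by move=> k; rewrite /pick; case: (split k).
  rewrite big_split_ord /=; congr (_ + _); apply: eq_bigr => i _.
  + by rewrite /pick (unsplitK (inl i)).
  + by rewrite /pick (unsplitK (inr i)).
- move=> a _ Aa [n [f [g [If Jg ->]]]]; exists n, (fun i => a * f i), g.
  split=> // [i|]; first exact: IZ.
  by rewrite mulr_sumr; apply: eq_bigr => i _; rewrite mulrA.
Qed.

Lemma colon_submodule A J I : submodule A J -> submodule A (colon J I).
Proof.
move=> mJ; split.
- by move=> y _; rewrite mul0r; apply: (submodule0 mJ).
- by move=> x y Jx Jy z Iz; rewrite mulrDl; apply: (submoduleD mJ); auto.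
- by move=> a x Aa Jx z Iz; rewrite -mulrA; apply: (submoduleZ mJ); auto.
Qed.

(** Together with [span_min] and [prod_ideal_min], this lets a condition on products be checked on
    generators, one factor at a time. *)
Lemma submodule_preimage A S x : submodule A S ->
  submodule A [set z | S (x * z)].
Proof.
move=> mS; split=> [|y z Sy Sz|a z Aa Sz] /=.
- by rewrite mulr0; apply: (submodule0 mS).
- by rewrite mulrDr; apply: (submoduleD mS).
- by rewrite mulrCA; apply: (submoduleZ mS).
Qed.

Lemma scale_submodule A a I : submodule A I -> submodule A (scale a I).
Proof.
move=> mI; split.
- by exists 0; [apply: (submodule0 mI) | rewrite mulr0].
- move=> _ _ [x Ix <-] [y Iy <-]; exists (x + y); last by rewrite mulrDr.
  exact: (submoduleD mI).
- move=> b _ Ab [x Ix <-]; exists (b * x); last by rewrite mulrCA.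
  exact: (submoduleZ mI).
Qed.

Lemma span_submodule A S (X : finType) (g : X -> K) :
  submodule A S -> submodule A (span S g).
Proof.
move=> mS; split.
- exists (fun=> 0); split=> [i|]; first exact: (submodule0 mS).
  by rewrite big1 // => i _; rewrite mul0r.
- move=> _ _ [c [Sc ->]] [c' [Sc' ->]]; exists (fun i => c i + c' i).
  split=> [i|]; first exact: (submoduleD mS).
  by rewrite -big_split; apply: eq_bigr => i _; rewrite mulrDl.
- move=> a _ Aa [c [Sc ->]]; exists (fun i => a * c i).
  split=> [i|]; first exact: (submoduleZ mS).
  by rewrite mulr_sumr; apply: eq_bigr => i _; rewrite mulrA.
Qed.

Lemma span_single S (X : finType) (g : X -> K) c i :
  S 0 -> S c -> span S g (c * g i).
Proof.
move=> S0 Sc; exists (fun j => if j == i then c else 0).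
split=> [j|]; first by case: eqP.
rewrite (bigD1 i) //= eqxx big1 ?addr0 // => j /negPf->.
by rewrite mul0r.
Qed.

Lemma span_gen A (X : finType) (g : X -> K) i : subring A -> span A g (g i).
Proof.
move=> rA; rewrite -[g i]mul1r.
by apply: span_single; [apply: subring0 | apply: subring1].
Qed.

Lemma span_min A S (X : finType) (g : X -> K) :
  submodule A S -> (forall i, S (g i)) -> span A g `<=` S.
Proof.
move=> mS Sg _ [c [Ac ->]]; apply: (submodule_sum mS) => i.
exact: (submoduleZ mS).
Qed.

Lemma spanS S T (X : finType) (g : X -> K) : S `<=` T -> span S g `<=` span T g.
Proof. by move=> ST x [c [Sc ->]]; exists c; split=> // i; apply/ST/Sc. Qed.

Lemma prod_span A (X Y : finType) (g : X -> K) (h : Y -> K) : subring A ->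
  prod_ideal (span A g) (span A h) =
  span A (fun ij : X * Y => g ij.1 * h ij.2).
Proof.
move=> rA; have mA := subring_submodule rA; apply/seteqP; split.
  have mS := span_submodule (fun ij : X * Y => g ij.1 * h ij.2) mA.
  apply: (prod_ideal_min mS) => x y gx; move: y.
  apply: (span_min (submodule_preimage x mS)) => j /=; rewrite mulrC.
  move: x gx; apply: (span_min (submodule_preimage _ mS)) => i /=.
  rewrite mulrC.
  exact: (span_gen (fun ij : X * Y => g ij.1 * h ij.2) (i, j) rA).
apply: span_min => [|ij]; last by apply: prod_idealP; apply: span_gen.
apply: prod_ideal_submodule => a x; apply: submoduleZ; exact: span_submodule.
Qed.

(** * Denominators and finitely generated ideals *)

Lemma has_fractionsP A x : has_fractions A ->
  exists d, [/\ A d, d != 0 & A (d * x)].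
Proof.
move=> /(_ x)[a [s [Aa As s0 ->]]]; exists s; split=> //.
by rewrite mulrC divfK.
Qed.

Lemma common_denominator A (X : finType) (g : X -> K) :
    subring A -> has_fractions A ->
  exists d, [/\ A d, d != 0 & forall i, A (d * g i)].
Proof.
move=> rA fA; have /choice[d dP] i := has_fractionsP (g i) fA.
have Aprod P : A (\prod_(i | P i) d i).
  elim/big_rec: _ => [|i x _ Ax]; first exact: subring1.
  by apply: subringM => //; case: (dP i).
exists (\prod_i d i); split=> // [|i].
  by apply/prodf_neq0 => i _; case: (dP i).
rewrite (bigD1 i) //= mulrAC; apply: subringM => //; by case: (dP i).
Qed.

(** A common denominator of the generators bounds the span, and the enumeration of [X] turns the
    family into one indexed by an ordinal. *)
Lemma fg_span A (X : finType) (g : X -> K) (i0 : X) : subring A ->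
  has_fractions A -> g i0 != 0 -> fg_ideal A (span A g).
Proof.
move=> rA fA gi0; split; first split.
- exact/span_submodule/subring_submodule.
- by exists (g i0) => //; apply: span_gen.
- have [d [Ad d0 dg]] := common_denominator g rA fA; exists d => //.
  split=> // x [c [Ac ->]].
  rewrite mulr_sumr; apply: (submodule_sum (subring_submodule rA)) => i.
  by rewrite mulrCA; apply: subringM.
exists #|X|, (fun i => g (enum_val i)); apply/seteqP; split=> x.
- move=> [c [Ac ->]]; exists (fun i => c (enum_val i)); split=> //.
  exact: (reindex _ (onW_bij _ (enum_val_bij X))).
- move=> [c [Ac ->]]; exists (fun i => c (enum_rank i)); split=> //.
  rewrite (reindex _ (onW_bij _ (enum_val_bij X))); apply: eq_bigr => i _.
  by rewrite enum_valK.
Qed.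

Lemma fg_idealP A I : fg_ideal A I ->
  exists n (g : 'I_n -> K), I = span A g /\ exists i, g i != 0.
Proof.
move=> [[_ [x Ix x0] _] [n [g defI]]]; exists n, g; split=> //.
apply: contrapT => g0; move: Ix x0; rewrite defI => -[c [_ ->]].
rewrite big1 ?eqxx // => i _; case: (eqVneq (g i) 0) => [->|gi].
  by rewrite mulr0.
by case: g0; exists i.
Qed.

(** * Fractional ideals *)

Lemma ideal_sub A I : ideal A I -> submodule A I.
Proof. by case. Qed.

Lemma ideal_self A : subring A -> ideal A A.
Proof.
move=> rA; split; first exact: subring_submodule.
  by exists 1; [apply: subring1 | apply: oner_neq0].
exists 1; [exact: subring1 | split; first exact: oner_neq0].
by move=> x; rewrite mul1r.
Qed.

Lemma integral_idealP A I x : subring A -> submodule A I -> I `<=` A ->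
  I x -> x != 0 -> ideal A I.
Proof.
move=> rA mI IA Ix x0; split=> //; first by exists x.
exists 1; [exact: subring1 | split; first exact: oner_neq0].
by move=> y /IA; rewrite mul1r.
Qed.

Lemma ideal_integral_elt A I : subring A -> ideal A I ->
  exists z, [/\ A z, I z & z != 0].
Proof.
move=> rA [mI [x Ix x0] [d Ad [d0 dI]]]; exists (d * x).
by split; [exact: dI | exact: (submoduleZ mI) | rewrite mulf_neq0].
Qed.

Lemma ideal_prod A I J : subring A -> ideal A I -> ideal A J ->
  ideal A (prod_ideal I J).
Proof.
move=> rA [mI [x Ix x0] [d Ad [d0 dI]]] [mJ [y Jy y0] [e Ae [e0 eJ]]].
have mP : submodule A (prod_ideal I J).
  by apply: prod_ideal_submodule; case: mI.
split=> //; first by exists (x * y); [exact: prod_idealP | rewrite mulf_neq0].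
exists (d * e); first exact: subringM.
split; first by rewrite mulf_neq0.
move=> _ [n [f [g [If Jg ->]]]]; rewrite mulr_sumr.
apply: (submodule_sum (subring_submodule rA)) => i.
by rewrite mulrACA; apply: subringM; auto.
Qed.

Lemma ideal_scale A a I : subring A -> has_fractions A -> a != 0 ->
  ideal A I -> ideal A (scale a I).
Proof.
move=> rA fA a0 [mI [x Ix x0] [d Ad [d0 dI]]]; split.
- exact: scale_submodule.
- by exists (a * x); [exists x | rewrite mulf_neq0].
have [e [Ae e0 ea]] := has_fractionsP a fA.
exists (e * d); first exact: subringM.
split; first by rewrite mulf_neq0.
by move=> _ [y Iy <-]; rewrite mulrACA; apply: subringM; auto.
Qed.

(** Denominators and elements exchange roles: a denominator of [I] is a nonzero element of the
    colon, and a nonzero element of [I] in [A] is a denominator of it. *)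
Lemma ideal_colon A I : subring A -> ideal A I -> ideal A (colon A I).
Proof.
move=> rA iI; have [z [Az Iz z0]] := ideal_integral_elt rA iI.
case: iI => mI _ [d Ad [d0 dI]]; split.
- exact/colon_submodule/subring_submodule.
- by exists d => // x; apply: dI.
by exists z => //; split=> // x xI; rewrite mulrC; apply: xI.
Qed.

Lemma ideal_conductor A I x : subring A -> has_fractions A -> ideal A I ->
  ideal A (principal_conductor A I x).
Proof.
move=> rA fA iI; have [z [Az Iz z0]] := ideal_integral_elt rA iI.
have [d [Ad d0 dx]] := has_fractionsP x fA.
have mI := ideal_sub iI.
(* If [d] clears the denominator of [x] and [z] lies in [I], then [d * z * x] is the multiple
   [(d * x) * z] of [z], so [d * z] is a nonzero element of the conductor. *)
apply: (@integral_idealP _ _ (d * z)) => //; last by rewrite mulf_neq0.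
- split.
  + by split; [exact: subring0 | rewrite mul0r; apply: (submodule0 mI)].
  + move=> s t [As Is] [At It]; split; first exact: subringD.
    by rewrite mulrDl; apply: (submoduleD mI).
  + move=> a s Aa [As Is]; split; first exact: subringM.
    by rewrite -mulrA; apply: (submoduleZ mI).
- by move=> s [].
- split; first exact: subringM.
  by rewrite mulrAC; apply: (submoduleZ mI).
Qed.

Lemma prod_scale A a I : submodule A I -> subring A ->
  prod_ideal I (scale a A) = scale a I.
Proof.
move=> mI rA; apply/seteqP; split.
  apply: (prod_ideal_min (scale_submodule a mI)) => x _ Ix [b Ab <-].
  by exists (b * x); [apply: (submoduleZ mI) | rewrite mulrA mulrC].
move=> _ [x Ix <-]; rewrite mulrC; apply: prod_idealP => //.
by exists 1; [apply: subring1 | rewrite mulr1].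
Qed.

Lemma scaleK a I : a != 0 -> scale a^-1 (scale a I) = I.
Proof.
move=> a0; apply/seteqP; split=> [_ [_ [x Ix <-] <-]|x Ix].
  by rewrite mulKf.
by exists (a * x); [exists x | rewrite mulKf].
Qed.

Lemma fg_prod A I J : subring A -> has_fractions A ->
    fg_ideal A I -> fg_ideal A J ->
  fg_ideal A (prod_ideal I J).
Proof.
move=> rA fA /fg_idealP[m [g [-> [i gi]]]] /fg_idealP[n [h [-> [j hj]]]].
rewrite prod_span //; apply: (@fg_span _ _ _ (i, j)) => //=.
by rewrite mulf_neq0.
Qed.

Lemma fg_self A : subring A -> fg_ideal A A.
Proof.
move=> rA; split; first exact: ideal_self.
exists 1, (fun=> 1); apply/seteqP; split=> [a Aa|_ [c [Ac ->]]].
  by exists (fun=> a); rewrite big_ord1 mulr1.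
by rewrite big_ord1 mulr1.
Qed.

(* If [g = C g] with [C] a matrix over [b], then [det (1 - C)] annihilates [g]
   and is congruent to [1] modulo [b]. *)
Lemma determinant_trick B b n (g : 'I_n -> K) (i0 : 'I_n) :
    subring B -> submodule B b -> b `<=` B -> g i0 != 0 ->
    (forall i, span b g (g i)) ->
  b 1.
Proof.
move=> rB mb bB gi0 /choice[c cP].
pose C : 'M[K]_n := \matrix_(i, j) c i j.
pose G : 'cV[K]_n := \col_i g i.
have CG : (1%:M - C) *m G = 0.
  rewrite mulmxBl mul1mx; apply/eqP; rewrite subr_eq0; apply/eqP/colP => i.
  by rewrite !mxE; case: (cP i) => _ {1}->; apply: eq_bigr => j _; rewrite !mxE.
have det0 : \det (1%:M - C) = 0.
  have : \det (1%:M - C) *: G = 0.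
    by rewrite -mul_scalar_mx -mul_adj_mx -mulmxA CG mulmx0.
  move=> /colP/(_ i0); rewrite !mxE => /eqP.
  by rewrite mulf_eq0 (negPf gi0) orbF => /eqP.
pose congr x y := [/\ B x, B y & b (x - y)].
have bN x : b x -> b (- x).
  move=> bx; rewrite -mulN1r; apply: (submoduleZ mb) => //.
  exact: (subringN rB (subring1 rB)).
have congrM x x' y y' : congr x y -> congr x' y' -> congr (x * x') (y * y').
  move=> [Bx By bxy] [Bx' By' bxy']; split; try exact: subringM.
  have -> : x * x' - y * y' = x * (x' - y') + y' * (x - y).
    by rewrite !mulrBr [y' * x]mulrC [y' * y]mulrC subrKA.
  by apply: (submoduleD mb); apply: (submoduleZ mb).
have congrD x x' y y' : congr x y -> congr x' y' -> congr (x + x') (y + y').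
  move=> [Bx By bxy] [Bx' By' bxy']; split; try exact: subringD.
  by rewrite opprD addrACA; apply: (submoduleD mb).
have congrr x : B x -> congr x x.
  by move=> Bx; split; rewrite // subrr; apply: (submodule0 mb).
have B1 := subring1 rB; have B0 := subring0 rB.
have : congr (\det (1%:M - C)) (\det (1%:M : 'M[K]_n)).
  (* The congruence passes through the Leibniz formula: first the sum over permutations, then each
     product of entries. *)
  apply: (big_ind2 congr) => [|x y x' y'|s _]; [exact: congrr|exact: congrD|].
  apply: (congrM).
    by apply: congrr; case: (perm.odd_perm s); [exact: subringN|].
  apply: (big_ind2 congr) => [|x y x' y'|i _]; [exact: congrr|exact: congrM|].
  have bc : b (c i (perm.fun_of_perm s i)) by case: (cP i).
  have Bd : B (i == perm.fun_of_perm s i)%:R by case: (i == _).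
  rewrite !mxE; split=> //; last by rewrite addrAC subrr add0r; exact: bN.
  by apply: subringD => //; apply: subringN => //; apply: bB.
by rewrite det0 det1 => -[_ _]; rewrite sub0r => /bN; rewrite opprK.
Qed.

(** * Localization at a prime *)

Section Localization.
Variables (A M : set K).
Hypotheses (rA : subring A) (M1 : ~ M 1)
  (primeM : forall x y, A x -> A y -> M (x * y) -> M x \/ M y).

Let outM s t : A s -> A t -> ~ M s -> ~ M t -> ~ M (s * t).
Proof. by move=> As At Ms Mt /primeM[]. Qed.

Lemma at_loc_sub S : S `<=` at_loc A M S.
Proof.
by move=> x Sx; exists 1; rewrite mul1r; split=> //; apply: subring1.
Qed.

Lemma at_locS S T : S `<=` T -> at_loc A M S `<=` at_loc A M T.
Proof. by move=> ST x [s [As Ms Sx]]; exists s; split=> //; apply: ST. Qed.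

(** The complement of a prime is closed under products. Later uses clear one denominator first and
    then argue locally again. *)
Lemma at_loc_idem S : at_loc A M (at_loc A M S) `<=` at_loc A M S.
Proof.
move=> x [s [As Ms [t [At Mt Sx]]]]; exists (t * s).
by split; [exact: subringM | exact: outM | rewrite -mulrA].
Qed.

Lemma at_loc_submodule D S : A `<=` D -> submodule D S ->
  submodule (at_loc A M D) (at_loc A M S).
Proof.
move=> AD mS; split.
- exact/at_loc_sub/(submodule0 mS).
- move=> x y [s [As Ms Sx]] [t [At Mt Sy]]; exists (s * t).
  split; [exact: subringM | exact: outM | rewrite mulrDr].
  apply: (submoduleD mS); last by rewrite -mulrA; apply: (submoduleZ mS); auto.
  by rewrite [s * t]mulrC -mulrA; apply: (submoduleZ mS); auto.
- move=> x y [s [As Ms Dx]] [t [At Mt Sy]]; exists (s * t).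
  split; [exact: subringM | exact: outM | rewrite mulrACA].
  exact: (submoduleZ mS).
Qed.

Lemma at_loc_subring D : A `<=` D -> subring D -> subring (at_loc A M D).
Proof.
move=> AD rD; have mD := at_loc_submodule AD (subring_submodule rD).
have D1 : at_loc A M D 1 by apply: at_loc_sub; apply: subring1.
split=> // x y Dx Dy; last exact: (submoduleZ mD).
apply: (submoduleD mD) => //; rewrite -mulN1r; apply: (submoduleZ mD) => //.
by apply: at_loc_sub; apply: (subringN rD); apply: subring1.
Qed.

(** A finite sum of fractions has a common denominator outside [M]; [M 0] makes every denominator
    nonzero. *)
Lemma at_locE S : M 0 -> submodule A S -> prod_ideal S (loc A M) = at_loc A M S.
Proof.
move=> M0 mS; apply/seteqP; split.
  have mL : submodule A (at_loc A M S).
    exact: submoduleW (@at_loc_sub A) (at_loc_submodule (@subset_refl _ A) mS).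
  apply: (prod_ideal_min mL) => x _ Sx [a [s [Aa As Ms ->]]].
  exists s; split=> //; rewrite mulrCA [s * _]mulrC divfK.
    by rewrite mulrC; apply: (submoduleZ mS).
  by apply: contra_not_neq Ms => ->.
move=> x [s [As Ms Sx]]; have s0 : s != 0 by apply: contra_not_neq Ms => ->.
rewrite -(mulKf s0 x) mulrC; apply: prod_idealP => //.
by exists 1, s; rewrite div1r; split=> //; apply: subring1.
Qed.

End Localization.

(** * Star operations of finite type and their maximal ideals *)

Lemma fg_sub_chain n (g : 'I_n -> K) (F : set (set K)) :
    F !=set0 -> total_on F subset -> (forall i, (\bigcup_(X in F) X) (g i)) ->
  exists2 X, F X & forall i, X (g i).
Proof.
move=> [X0 FX0] totF; elim: n g => [|n IH] g gF.
  by exists X0 => // -[].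
have [X FX Xg] := IH (fun i => g (lift ord0 i)) (fun i => gF _).
have [Y FY Yg] := gF ord0.
case: (totF _ _ FX FY) => [XY|YX].
  exists Y => // i; case: (unliftP ord0 i) => [j ->|-> //].
  exact/XY/Xg.
exists X => // i; case: (unliftP ord0 i) => [j ->|->]; [exact: Xg | exact: YX].
Qed.

Section StarOperation.
Variables (A : set K) (star : set K -> set K).
Hypotheses (rA : subring A) (sA : star_operation A star).

Lemma star_ideal I : ideal A I -> ideal A (star I).
Proof. by case: sA => + _ _ _ _; apply. Qed.

Lemma star_self : star A = A.
Proof. by case: sA => _ []. Qed.

Lemma star_scale a I : a != 0 -> ideal A I ->
  star (scale a I) = scale a (star I).
Proof. by case: sA => _ [] _ + _ _ _; apply. Qed.

Lemma star_sub I : ideal A I -> I `<=` star I.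
Proof. by case: sA => _ _ + _ _; apply. Qed.

Lemma starS I J : ideal A I -> ideal A J -> I `<=` J -> star I `<=` star J.
Proof. by case: sA => _ _ _ + _; apply. Qed.

Lemma star_idem I : ideal A I -> star (star I) = star I.
Proof. by case: sA => _ _ _ _; apply. Qed.

Lemma star_submodule I : ideal A I -> submodule A (star I).
Proof. by move=> /star_ideal[]. Qed.

Lemma star_max_not1 M : star_max A star M -> ~ M 1.
Proof.
case=> -[[[mM _ _] MA] MnA _] _ M1; apply: MnA; apply/seteqP; split=> // x Ax.
by rewrite -(mulr1 x); apply: (submoduleZ mM).
Qed.

Lemma star_max0 M : star_max A star M -> M 0.
Proof. by case=> -[[[mM _ _] _] _ _] _; apply: (submodule0 mM). Qed.

(** If [x] is not in [M], put [N = M + A x]. Maximality of [M] forces [star N = A]. Since [y N] lies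
    in [M], applying [star] gives [y A] inside [star M = M]. *)
Lemma star_max_prime M x y : star_max A star M -> A x -> A y -> M (x * y) ->
  M x \/ M y.
Proof.
case=> -[[iM MA] MnA starM] maxM Ax Ay Mxy; apply: contrapT => /not_orP[Mx My].
have mM := ideal_sub iM.
pose N := [set z | exists m a, [/\ M m, A a & z = m + a * x]].
have M0 := submodule0 mM; have A0 := subring0 rA; have A1 := subring1 rA.
have MN : M `<=` N by move=> m Mm; exists m, 0; rewrite mul0r addr0.
have Nx : N x by exists 0, 1; rewrite mul1r add0r.
have NA : N `<=` A.
  move=> _ [m [a [Mm Aa ->]]]; apply: subringD => //; first exact: MA.
  exact: subringM.
have [_ [m Mm m0] _] := iM.
have iN : ideal A N.
  apply: (integral_idealP rA _ NA (MN _ Mm) m0); split.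
  - exact: MN.
  - move=> _ _ [u [a [Mu Aa ->]]] [v [b [Mv Ab ->]]].
    exists (u + v), (a + b); rewrite mulrDl addrACA; split=> //.
      exact: (submoduleD mM).
    exact: subringD.
  - move=> c _ Ac [u [a [Mu Aa ->]]]; exists (c * u), (c * a).
    rewrite mulrDr mulrA; split=> //; first exact: (submoduleZ mM).
    exact: subringM.
have sNA : star N `<=` A.
  by rewrite -star_self; apply: starS => //; apply: ideal_self.
have starN : star N = A.
  apply: contrapT => sN; apply: Mx.
  have <- : star N = M.
    apply: maxM; last by apply: subset_trans MN _; apply: star_sub.
    by split; [split=> //; apply: star_ideal | | apply: star_idem].
  exact: star_sub.
have y0 : y != 0 by apply: contra_not_neq My => ->.
have yNM : scale y N `<=` M.
  move=> _ [_ [u [a [Mu Aa ->]]] <-]; rewrite mulrDr; apply: (submoduleD mM).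
    exact: (submoduleZ mM).
  by rewrite mulrCA [y * x]mulrC; apply: (submoduleZ mM).
have iyN : ideal A (scale y N).
  apply: (@integral_idealP _ _ (y * m)) => //.
  - exact/scale_submodule/ideal_sub.
  - by apply: subset_trans yNM MA.
  - by exists m => //; apply: MN.
  - by rewrite mulf_neq0.
apply: My; rewrite -starM; apply: (starS iyN iM yNM).
by rewrite star_scale // starN; exists 1; rewrite ?mulr1.
Qed.

Lemma star_tildeP S x : submodule A S ->
  star_tilde A star S x <-> forall M, star_max A star M -> at_loc A M S x.
Proof.
move=> mS; split=> tSx M maxM.
  rewrite -at_locE //; first exact: tSx.
  - exact: star_max_not1.
  - by move=> u v; apply: star_max_prime.
  - exact: star_max0.
rewrite at_locE //; first exact: tSx.
- exact: star_max_not1.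
- by move=> u v; apply: star_max_prime.
- exact: star_max0.
Qed.

Hypothesis ftA : finite_type_op A star.

Lemma star_finite I x : ideal A I -> star I x ->
  exists J, [/\ fg_ideal A J, J `<=` I & star J x].
Proof. by move=> iI; rewrite ftA // => -[J [fJ JI] Jx]; exists J. Qed.

(** Zorn's lemma applies because finite type makes the union of a chain of star-ideals a star-ideal
    again. *)
Lemma star_max_exists Q : ideal A Q -> Q `<=` A -> star Q <> A ->
  exists2 N, star_max A star N & Q `<=` N.
Proof.
move=> iQ QA sQ.
have proper_star : proper_star_ideal A star (star Q).
  split=> //; last exact: star_idem.
  split; first exact: star_ideal.
  by rewrite -star_self; apply: starS => //; apply: ideal_self.
have QsQ := star_sub iQ; have [mQ [z Qz z0] _] := iQ.
(* The empty set is added because the union of the empty chain is empty. *)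
pose P := [set N | N = set0 \/ (proper_star_ideal A star N /\ Q `<=` N)].
have [|N [PN maxN]] := @Zorn_bigcup _ P.
  move=> F FP totF.
  have [[X0 FX0 [properX0 QX0]]|noX] :=
      pselect (exists2 X, F X & (proper_star_ideal A star X /\ Q `<=` X));
      last first.
    left; apply/seteqP; split=> // x [X FX]; case: (FP _ FX) => [->//|PX].
    by case: noX; exists X.
  (* Dropping the empty members does not change the union; all the others are proper star-ideals
     containing [Q]. *)
  right; pose G := [set X | F X /\ X !=set0].
  have GP X : G X -> proper_star_ideal A star X /\ Q `<=` X.
    by move=> [/FP[->|//] [x]].
  have GX0 : G X0 by split=> //; exists z; apply: QX0.
  have totG : total_on G subset by move=> X Y [FX _] [FY _]; apply: totF.
  have -> : \bigcup_(X in F) X = \bigcup_(X in G) X.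
    apply/seteqP; split=> x [X FX Xx]; exists X => //; last by case: FX.
    by split=> //; exists x.
  set U := \bigcup_(X in G) X.
  have UA : U `<=` A by move=> x [X /GP[[[_ XA] _ _] _]]; apply: XA.
  have QU : Q `<=` U by move=> x Qx; exists X0 => //; apply: QX0.
  have mG X : G X -> submodule A X by move=> /GP[[[[]]]].
  have iU : ideal A U.
    apply: (integral_idealP rA _ UA (QU _ Qz) z0); split.
    - exact/QU/(submodule0 mQ).
    - move=> x y [X GX Xx] [Y GY Yy]; case: (totG _ _ GX GY) => [XY|YX].
        by exists Y => //; apply: (submoduleD (mG _ GY)) => //; apply: XY.
      by exists X => //; apply: (submoduleD (mG _ GX)) => //; apply: YX.
    - by move=> a x Aa [X GX Xx]; exists X => //; apply: (submoduleZ (mG _ GX)).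
  split=> //; split=> // [UeA|].
    have [X GX X1] : U 1 by rewrite UeA; apply: subring1.
    have [[[_ XA] XnA _] _] := GP _ GX; apply: XnA.
    apply/seteqP; split=> // x Ax; rewrite -(mulr1 x).
    exact: (submoduleZ (mG _ GX)).
  apply/seteqP; split; last exact: star_sub.
  (* An element of [star U] already lies in [star J] for a finitely generated [J] inside [U]; the
     generators of [J], hence [star J], lie in a single member of the chain. *)
  move=> x /(star_finite iU)[J [fJ JU Jx]].
  have [n [g [defJ _]]] := fg_idealP fJ.
  have [|||X GX Xg] := @fg_sub_chain n g G; [by exists X0|by []| |].
    by move=> i; apply: JU; rewrite defJ; apply: span_gen.
  exists X => //; have [[[iX _] _ <-] _] := GP _ GX.
  apply: (starS (proj1 fJ) iX) Jx; rewrite defJ.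
  exact: span_min (mG _ GX) Xg.
have {PN} [N0|[properN QN]] := PN.
  (* The maximal element cannot be the empty set, since [star Q] is admissible and nonempty. *)
  case: (maxN (star Q)); last by right.
  rewrite N0 properEneq; split; last exact: sub0set.
  by apply/eqP => e; have := QsQ _ Qz; rewrite -e.
exists N => //; split=> // N' properN' NN'.
apply: contrapT => N'N; apply: (maxN N').
  by rewrite properEneq; split=> //; apply/eqP => e; apply: N'N.
by right; split=> //; apply: subset_trans QN NN'.
Qed.

(** If [x] is locally in [I], its conductor [Q] lies in no star-maximal ideal, so [star Q = A].
    Applying [star] to the inclusion of [x Q] in [I] puts [x] in [star I]. *)
Lemma star_tilde_sub I : has_fractions A -> ideal A I ->
  star_tilde A star I `<=` star I.
Proof.
move=> fA iI x /(star_tildeP _ (ideal_sub iI)) tIx.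
have iQ := ideal_conductor x rA fA iI.
have QA : principal_conductor A I x `<=` A by move=> s [].
have sQ : star (principal_conductor A I x) = A.
  apply: contrapT => /(star_max_exists iQ QA)[N maxN QN].
  by have [s [As Ns Isx]] := tIx N maxN; apply/Ns/QN.
have [->|x0] := eqVneq x 0; first exact: (submodule0 (star_submodule iI)).
apply: (@starS (scale x (principal_conductor A I x))) => //.
- exact: ideal_scale.
- by move=> _ [s [_ Isx] <-]; rewrite mulrC.
rewrite star_scale // sQ; exists 1; first exact: subring1.
by rewrite mulr1.
Qed.

(** For [x] in the [v]-closure, [x I (A : I)] lies in [I]; invertibility turns this into [x] in
    [star I]. Conversely, if [y I] lies in [A], then so does [y] times [star I]. *)
Lemma v_op_star I : has_fractions A -> ideal A I ->
    star (prod_ideal I (colon A I)) = A ->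
  v_op A I = star I.
Proof.
move=> fA iI invI; have iC := ideal_colon rA iI.
have iP := ideal_prod rA iI iC.
apply/seteqP; split=> x vx.
  have [->|x0] := eqVneq x 0; first exact: (submodule0 (star_submodule iI)).
  apply: (@starS (scale x (prod_ideal I (colon A I)))) => //.
  - exact: ideal_scale.
  - move=> _ [y Py <-]; move: y Py.
    have mI := ideal_sub iI.
    apply: (prod_ideal_min (submodule_preimage x mI)) => u y Iu Cy /=.
    by rewrite [u * y]mulrC mulrA; apply: (submoduleZ mI) => //; apply: vx.
  rewrite star_scale // invI; exists 1; first exact: subring1.
  by rewrite mulr1.
move=> y Cy; have [->|y0] := eqVneq y 0.
  by rewrite mulr0; apply: subring0.
rewrite mulrC -star_self.
apply: (@starS (scale y I)); [exact: ideal_scale|exact: ideal_self| |].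
  by move=> _ [u Iu <-]; apply: Cy.
by rewrite star_scale //; exists x.
Qed.

(** Both sides are unions over the same finitely generated [J], on which [v] and [star] agree by
    invertibility. *)
Lemma t_op_star I : has_fractions A ->
    (forall J, fg_ideal A J -> star (prod_ideal J (colon A J)) = A) ->
    ideal A I ->
  t_op A I = star I.
Proof.
move=> fA inv iI; rewrite ftA //; apply/seteqP; split=> x [J [fJ JI]].
  by rewrite v_op_star //; [exists J | case: fJ | apply: inv].
by move=> Jx; exists J => //; rewrite v_op_star //; [case: fJ | apply: inv].
Qed.

End StarOperation.

(** Needed because operations are compared on fractional ideals only, so they cannot be rewritten as
    functions. *)
Lemma star_max_ext A s1 s2 : eq_on_ideals A s1 s2 ->
  star_max A s1 = star_max A s2.
Proof.
move=> e; have p N : proper_star_ideal A s1 N <-> proper_star_ideal A s2 N.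
  by split=> -[[iN NA] NnA sN]; split=> //; have := e _ iN; rewrite sN.
by apply/seteqP; split=> M [/p pM maxM]; split=> // N /p; apply: maxM.
Qed.

(** * The star-integral closure as an overring *)

Section Closure.
Variables (A : set K) (star : set K -> set K).
Hypotheses (rA : subring A) (fA : has_fractions A)
  (sA : star_operation A star) (ftA : finite_type_op A star)
  (tildeA : eq_on_ideals A star (star_tilde A star)).

Local Notation D := (star_integral_closure A star).
Local Notation dot := (star_tilde A star).
Local Notation Max := (star_max A star).

Let tildeP := star_tildeP rA sA.
Let Max_prime := star_max_prime rA sA.

Lemma star_at_locP I x : ideal A I ->
  star I x <-> forall M, Max M -> at_loc A M I x.
Proof. by move=> iI; rewrite tildeA //; apply/tildeP/ideal_sub. Qed.

(** A compactness property of the set of star-maximal ideals. The hypothesis says that [1] is in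
    [star Q]; by finite type [1] is in [star J] for a finitely generated [J] inside [Q], and the
    generators of [J] do the work. *)
Lemma finite_witness Q : submodule A Q -> Q `<=` A ->
    (forall M, Max M -> exists2 s, Q s & ~ M s) ->
  exists n (f : 'I_n -> K),
    (forall i, Q (f i)) /\ forall M, Max M -> exists i, ~ M (f i).
Proof.
move=> mQ QA avoid.
(* If [Q] has no nonzero element, the hypothesis leaves no star-maximal ideal at all, since each
   contains [0]; the empty family then works. *)
have [[x Qx x0]|Q0] := pselect (exists2 x, Q x & x != 0); last first.
  exists 0, (fun=> 0); split=> [[]//|M maxM].
  have [s Qs Ms] := avoid M maxM; case: Ms.
  have [->|s0] := eqVneq s 0; first exact: star_max0 maxM.
  by case: Q0; exists s.
have iQ := integral_idealP rA mQ QA Qx x0.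
have sQ1 : star Q 1.
  apply/(star_at_locP _ iQ) => M maxM; have [s Qs Ms] := avoid M maxM.
  by exists s; rewrite mulr1; split=> //; apply: QA.
have [J [fJ JQ sJ1]] := star_finite ftA iQ sQ1.
have [n [g [defJ _]]] := fg_idealP fJ.
exists n, g; split=> [i|M maxM].
  by apply: JQ; rewrite defJ; apply: span_gen.
apply: contrapT => /forallNP gM.
have [s [_ Ms]] := (star_at_locP _ (proj1 fJ)).1 sJ1 M maxM.
rewrite mulr1 defJ => gs; apply: Ms.
have [[[mM _ _] _] _ _] := proj1 maxM.
by apply: (span_min mM _ gs) => i; apply: contrapT; apply: gM.
Qed.

(** An element [y] of [star J] has locally a multiple [s * y] in [J], so it suffices to test [x] on
    [J]. *)
Lemma colon_starP J x : ideal A J ->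
  colon (star J) (star J) x <-> forall z, J z -> star J (x * z).
Proof.
move=> iJ; split=> [Jx z Jz|Jx y sJy]; first exact/Jx/(star_sub sA).
apply/(star_at_locP _ iJ) => M maxM.
have [s [As Ms Jsy]] := (star_at_locP _ iJ).1 sJy M maxM.
apply: (at_loc_idem rA (fun u v => Max_prime maxM)).
exists s; split=> //; rewrite mulrCA.
exact: (star_at_locP _ iJ).1 (Jx _ Jsy) M maxM.
Qed.

Lemma colon_star_subring J : ideal A J -> subring (colon (star J) (star J)).
Proof.
move=> iJ; have mJ := star_submodule sA iJ; split.
- by move=> y; rewrite mul1r.
- move=> x y Jx Jy z Jz; rewrite mulrBl.
  apply: (submoduleD mJ); first exact: Jx.
  rewrite -mulN1r; apply: (submoduleZ mJ); last exact: Jy.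
  by apply: (subringN rA); apply: subring1.
- by move=> x y Jx Jy z Jz; rewrite -mulrA; apply/Jx/Jy.
Qed.

(** This makes the union defining [D] directed: the colons of [I] and of [J] both embed in that of
    the product. *)
Lemma colon_star_prodl I J : ideal A I -> ideal A J ->
  colon (star I) (star I) `<=`
  colon (star (prod_ideal I J)) (star (prod_ideal I J)).
Proof.
move=> iI iJ; have iP := ideal_prod rA iI iJ => x /(colon_starP _ iI) Ix.
apply/(colon_starP _ iP).
have mS := submodule_preimage x (star_submodule sA iP).
apply: (prod_ideal_min mS) => u v Iu Jv; apply/(star_at_locP _ iP) => M maxM.
have [s [As Ms Isxu]] := (star_at_locP _ iI).1 (Ix _ Iu) M maxM.
by exists s; split=> //; rewrite !mulrA -[s * x * u]mulrA; apply: prod_idealP.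
Qed.

Lemma closure_directed n (x : 'I_n -> K) : (forall i, D (x i)) ->
  exists2 J, fg_ideal A J & forall i, colon (star J) (star J) (x i).
Proof.
elim: n x => [|n IH] x Dx; first by exists A; [apply: fg_self | case].
have [J fJ Jx] := IH (fun i => x (lift ord0 i)) (fun i => Dx _).
have [I fI Ix] := Dx ord0; have [iI iJ] := (proj1 fI, proj1 fJ).
exists (prod_ideal I J) => [|i]; first exact: fg_prod.
case: (unliftP ord0 i) => [j ->|->]; last exact: (colon_star_prodl iI iJ).
by rewrite prod_idealC; apply: (colon_star_prodl iJ iI).
Qed.

Lemma sub_closure : A `<=` D.
Proof.
move=> a Aa; exists A; first exact: fg_self.
by rewrite (star_self sA) => b; apply: subringM.
Qed.

Lemma closure_subring : subring D.
Proof.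
have directed2 x y : D x -> D y -> exists2 J, fg_ideal A J &
    colon (star J) (star J) x /\ colon (star J) (star J) y.
  move=> Dx Dy; have [|J fJ Jxy] := @closure_directed 2 (fun i => [:: x; y]`_i).
    by case=> -[|[]].
  by exists J => //; split; [apply: (Jxy 0) | apply: (Jxy 1)].
split; first by apply: sub_closure; apply: subring1.
- move=> x y Dx Dy; have [J fJ [Jx Jy]] := directed2 x y Dx Dy; exists J => //.
  by have [_ JB _] := colon_star_subring (proj1 fJ); apply: JB.
- move=> x y Dx Dy; have [J fJ [Jx Jy]] := directed2 x y Dx Dy; exists J => //.
  exact: (subringM (colon_star_subring (proj1 fJ))).
Qed.

Lemma closure_has_fractions : has_fractions D.
Proof.
move=> x; have [a [s [Aa As s0 ->]]] := fA x.
by exists a, s; split=> //; apply: sub_closure.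
Qed.

(** * The induced operation on the closure *)

Let rD := closure_subring.
Let mD := subring_submodule rD.
Let fD := closure_has_fractions.

Let dotP S x : submodule D S ->
  dot S x <-> forall M, Max M -> at_loc A M S x.
Proof. by move=> mS; apply/tildeP/(submoduleW sub_closure). Qed.

Let sub_local M S x : Max M -> S x -> at_loc A M S x.
Proof. by move=> /star_max_not1 M1; apply: at_loc_sub. Qed.

Let at_locD_subring M : Max M -> subring (at_loc A M D).
Proof.
move=> maxM; apply: at_loc_subring rD => //; last exact: sub_closure.
- exact: star_max_not1 maxM.
- by move=> u v; apply: Max_prime.
Qed.

Let at_locD_submodule M S : Max M -> submodule D S ->
  submodule (at_loc A M D) (at_loc A M S).
Proof.
move=> maxM; apply: at_loc_submodule => //; last exact: sub_closure.
- exact: star_max_not1 maxM.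
- by move=> u v; apply: Max_prime.
Qed.

(** If [x] is locally in [D], finitely many [f i] in [A], not all in any one star-maximal [M],
    satisfy [f i * x] in [D]. Directedness gives one [J] whose colon contains every [f i * x];
    locally some [f i] is a unit, so [x] itself belongs to the colon. *)
Lemma dot_closure : dot D = D.
Proof.
apply/seteqP; split=> x; last first.
  move=> Dx; apply/(dotP _ mD) => M maxM.
  exact: sub_local.
move=> /(dotP _ mD) Dx; pose Q := principal_conductor A D x.
have mQ : submodule A Q.
  split.
  - by split; [apply: subring0 | rewrite mul0r; apply: subring0].
  - move=> s t [As Ds] [At Dt]; split; first exact: subringD.
    by rewrite mulrDl; apply: subringD.
  - move=> a s Aa [As Ds]; split; first exact: subringM.
    by rewrite -mulrA; apply: subringM => //; apply: sub_closure.
have [||n [f [Qf witness]]] := @finite_witness Q mQ; first by move=> s [].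
  by move=> M /Dx[s [As Ms Dsx]]; exists s.
have [J fJ Jf] := @closure_directed n (fun i => f i * x) (fun i => (Qf i).2).
have iJ := proj1 fJ; exists J => //; apply/(colon_starP _ iJ) => z Jz.
apply/(star_at_locP _ iJ) => M maxM; have [i Mfi] := witness M maxM.
apply: (at_loc_idem rA (fun u v => Max_prime maxM)).
exists (f i); split=> //; first by case: (Qf i).
rewrite mulrA; apply: (star_at_locP _ iJ).1 => //.
exact/Jf/(star_sub sA).
Qed.

Lemma dot_star_operation : star_operation D dot.
Proof.
have subdot I : submodule D I -> I `<=` dot I.
  move=> mI x Ix; apply/(dotP _ mI) => M maxM.
  exact: sub_local.
have mdot I : submodule D I -> submodule D (dot I).
  move=> mI; split; first exact/subdot/(submodule0 mI).
  - move=> x y /(dotP _ mI) Ix /(dotP _ mI) Iy; apply/(dotP _ mI) => M maxM.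
    by apply: (submoduleD (at_locD_submodule maxM mI)); auto.
  - move=> a x Da /(dotP _ mI) Ix; apply/(dotP _ mI) => M maxM.
    apply: (submoduleZ (at_locD_submodule maxM mI)); last exact: Ix.
    exact: sub_local.
have dotS I J : submodule D I -> submodule D J -> I `<=` J -> dot I `<=` dot J.
  move=> mI mJ IJ x /(dotP _ mI) Ix; apply/(dotP _ mJ) => M maxM.
  exact: at_locS IJ _ (Ix M maxM).
split.
- move=> I iI; have [mI [x Ix x0] [d Dd [d0 dI]]] := iI; split.
  + exact: mdot.
  + by exists x => //; apply: subdot.
  (* The denominator [d] of [I] still works for [dot I], because [d * y] is locally in [D] and
     [dot D = D]. *)
  exists d => //; split=> // y /(dotP _ mI) Iy; rewrite -dot_closure.
  apply/(dotP _ mD) => M maxM; have [s [As Ms Isy]] := Iy M maxM.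
  by exists s; split=> //; rewrite mulrCA; apply: dI.
- split; first exact: dot_closure.
  move=> a I a0 [mI _ _]; have mS := scale_submodule a mI.
  apply/seteqP; split=> [x /(dotP _ mS) aIx|_ [x /(dotP _ mI) Ix <-]].
    exists (a^-1 * x); last by rewrite mulVKf.
    apply/(dotP _ mI) => M maxM; have [s [As Ms [y Iy ysx]]] := aIx M maxM.
    by exists s; split=> //; rewrite mulrCA -ysx mulKf.
  apply/(dotP _ mS) => M maxM; have [s [As Ms Isx]] := Ix M maxM.
  by exists s; split=> //; exists (s * x) => //; rewrite mulrCA.
- by move=> I [mI _ _]; apply: subdot.
- by move=> I J [mI _ _] [mJ _ _]; apply: dotS.
- move=> I [mI _ _]; apply/seteqP; split; last exact/subdot/mdot.
  move=> x /(dotP _ (mdot _ mI)) Ix; apply/(dotP _ mI) => M maxM.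
  apply: (at_loc_idem rA (fun u v => Max_prime maxM)).
  have [s [As Ms sIsx]] := Ix M maxM; exists s; split=> //.
  by move/(dotP _ mI): sIsx; apply.
Qed.

Let sD := dot_star_operation.

Lemma dot_finite_type : finite_type_op D dot.
Proof.
move=> I iI; have [mI [z Iz z0] _] := iI.
apply/seteqP; split; last first.
  by move=> x [J [[iJ _] JI]]; apply: (starS sD).
move=> x dIx.
pose Q := principal_conductor A I x.
have mQ : submodule A Q.
  have := submoduleW sub_closure mI => -[I0 ID IZ]; split.
  - by split; [apply: subring0 | rewrite mul0r].
  - move=> s t [As Is] [At It]; split; first exact: subringD.
    by rewrite mulrDl; apply: ID.
  - move=> a s Aa [As Is]; split; first exact: subringM.
    by rewrite -mulrA; apply: IZ.
have [||n [f [Qf witness]]] := @finite_witness Q mQ; first by move=> s [].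
  by move=> M maxM; have [s [As Ms Isx]] := (dotP x mI).1 dIx M maxM; exists s.
(* The finitely many [f i * x] in [I] already capture [x] locally; the extra generator [z] ensures
   that the span is nonzero. *)
pose g (o : option 'I_n) := if o is Some i then f i * x else z.
have fJ : fg_ideal D (span D g) by apply: (@fg_span _ _ _ None).
exists (span D g).
  split=> //; apply: (span_min mI) => -[i|//]; exact: (Qf i).2.
apply/(dotP _ (ideal_sub (proj1 fJ))) => M maxM; have [i Mfi] := witness M maxM.
exists (f i); split=> //; first exact: (Qf i).1.
exact: (span_gen g (Some i) rD).
Qed.

Let ftD := dot_finite_type.

(** * Clifford regularity *)

(** Regularity is applied to the [A]-span of [g], while the conclusion concerns its [D]-span:
    together the two clauses say that [J] generates an inverse of the latter for the induced
    operation. *)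
Lemma regular_fg_inverse n (g : 'I_n -> K) (i0 : 'I_n) J : g i0 != 0 ->
    ideal A J ->
    let I := span A g in
    star I = star (prod_ideal (prod_ideal I I) J) ->
  (forall i y, J y -> D (g i * y)) /\
  forall M, Max M -> at_loc A M (prod_ideal (span D g) J) 1.
Proof.
move=> gi0 iJ I starI.
have fI : fg_ideal A I by apply: fg_span gi0.
have iI := proj1 fI; have Ig i : I (g i) by apply: span_gen.
set P := prod_ideal _ J in starI.
have iP : ideal A P by do !apply: ideal_prod.
have Dg i y : J y -> D (g i * y).
  move=> Jy; exists I => //; apply/(colon_starP _ iI) => z Iz.
  rewrite starI; apply: (star_sub sA iP); rewrite mulrAC.
  by do !apply: prod_idealP.
split=> // M maxM; set b := prod_ideal _ J.
have mb : submodule D b.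
  apply: prod_ideal_submodule => a x; apply: submoduleZ.
  exact: span_submodule.
have bD : b `<=` D.
  apply: (prod_ideal_min mD) => x y gx Jy; rewrite mulrC; move: x gx.
  apply: (span_min (submodule_preimage y mD)) => i /=; rewrite mulrC.
  exact: Dg.
apply: (determinant_trick (at_locD_subring maxM) _ (at_locS bD) gi0).
  exact: at_locD_submodule.
move=> i; have : star I (g i) by apply: (star_sub sA).
rewrite starI => /(star_at_locP _ iP)/(_ M maxM)[s [As Ms Psg]].
have s0 : s != 0 by apply: contra_not_neq Ms => ->; apply: star_max0 maxM.
have mT : submodule A (span b g).
  exact/span_submodule/(submoduleW sub_closure).
(* A product [u * v * y] is regrouped as [(u * y) * v]: the first factor lies in [b], and [v] is
   expanded in the generators. *)
have PT : P `<=` span b g.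
  apply: (prod_ideal_min mT) => x y + Jy; rewrite mulrC; move: x.
  apply: (prod_ideal_min (submodule_preimage y mT)) => u v Iu Iv /=.
  rewrite mulrA; move: v Iv.
  apply: (span_min (submodule_preimage _ mT)) => j /=.
  apply: span_single; first exact: submodule0 mb.
  rewrite mulrC; apply: prod_idealP => //.
  exact: spanS sub_closure _ Iu.
have [c [bc defsg]] := PT _ Psg.
(* Dividing the coefficients by [s], a unit at [M], moves them from [b] into its localization. *)
exists (fun j => s^-1 * c j); split=> [j|].
  by exists s; rewrite mulVKf.
rewrite -[g i](mulKf s0) defsg mulr_sumr.
by apply: eq_bigr => j _; rewrite mulrA.
Qed.

Lemma clifford_closure_invertible : clifford_regular A star ->
  forall I, fg_ideal D I -> dot (prod_ideal I (colon D I)) = D.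
Proof.
move=> cliff I /fg_idealP[n [g [-> [i0 gi0]]]].
have [J iJ starI] := cliff _ (proj1 (fg_span rA fA gi0)).
have [Dg inv] := regular_fg_inverse gi0 iJ starI.
set P := prod_ideal _ _.
have iI := proj1 (fg_span rD fD gi0).
have iP := ideal_prod rD iI (ideal_colon rD iI).
have PD : P `<=` D.
  by apply: (prod_ideal_min mD) => x y Ix Iy; rewrite mulrC; apply: Iy.
apply/seteqP; split.
  by rewrite -dot_closure; apply: (starS sD) => //; apply: ideal_self.
have dP1 : dot P 1.
  apply/(dotP _ (ideal_sub iP)) => M maxM; apply: at_locS (inv M maxM).
  apply: prod_idealS => // y Jy.
  apply: (span_min (submodule_preimage y mD)) => i /=; rewrite mulrC.
  exact: Dg.
move=> x Dx; rewrite -[x]mulr1.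
by apply: (submoduleZ (star_submodule sD iP)).
Qed.

(** Here [N] ranges over the maximal ideals of [dot] on [D], not those of [star] on [A]. For [x] in
    [dot I] the conductor of [x] in [D] has closure containing [1], so no such [N] contains it. *)
Lemma dot_sub_tilde I : ideal D I -> dot I `<=` star_tilde D dot I.
Proof.
move=> iI x dIx; have mI := ideal_sub iI.
apply/(star_tildeP rD sD _ mI) => N maxN; apply: contrapT => noN.
have iQ := ideal_conductor x rD fD iI; set Q := principal_conductor D I x in iQ.
have QN : Q `<=` N.
  by move=> s [Ds Isx]; apply: contrapT => Ns; apply: noN; exists s.
have dQ1 : dot Q 1.
  apply/(dotP _ (ideal_sub iQ)) => M maxM.
  have [s [As Ms Isx]] := (dotP x mI).1 dIx M maxM.
  by exists s; split=> //; rewrite mulr1; split=> //; apply: sub_closure.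
apply: (star_max_not1 maxN); have [[[iN _] _ <-] _] := maxN.
exact: (starS sD iQ iN QN).
Qed.

Lemma clifford_closure : clifford_regular A star ->
  [/\ PstarMD D dot, eq_on_ideals D dot (w_op D)
    & eq_on_ideals D (w_op D) (t_op D)].
Proof.
move=> /clifford_closure_invertible inv.
have tD I : ideal D I -> t_op D I = dot I by move=> iI; exact: t_op_star.
have wD I : ideal D I -> w_op D I = dot I.
  (* Since [t_op D] and [dot] agree on ideals, they have the same maximal ideals, which reduces the
     claim to [dot] being equal to its own tilde. *)
  move=> iI; rewrite /w_op /star_tilde (star_max_ext tD); apply/seteqP; split.
    exact: star_tilde_sub.
  exact: dot_sub_tilde.
by split=> [|I iI|I iI]; rewrite ?wD ?tD.
Qed.

(** * Boole regularity and greatest common divisors *)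

(** Boole regularity gives the Clifford identity with [J] the principal ideal generated by the
    inverse of [x]. The two clauses together amount to the closure of the [D]-span of [g] being
    [x D]. *)
Lemma boole_regular_fg n (g : 'I_n -> K) (i0 : 'I_n) :
    boole_regular A star -> g i0 != 0 ->
  exists2 x, x != 0 & (forall i, D (g i * x^-1)) /\ dot (span D g) x.
Proof.
move=> boole gi0; have iI := proj1 (fg_span rA fA gi0).
have [x x0 starII] := boole _ iI; exists x => //.
have iII := ideal_prod rA iI iI.
have xV0 : x^-1 != 0 by rewrite invr_eq0.
have iJ := ideal_scale rA fA xV0 (ideal_self rA).
have [|Dg inv] := regular_fg_inverse gi0 iJ.
  rewrite prod_scale // ?(star_scale sA) ?starII ?scaleK //.
  exact: ideal_sub.
split=> [i|]; first by apply: Dg; exists 1; rewrite ?mulr1 //; apply: subring1.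
have mI : submodule D (span D g) by apply: span_submodule.
apply/(dotP _ mI) => M maxM; have [s [As Ms]] := inv M maxM.
rewrite (prod_scale _ (submoduleW sub_closure mI) rA) mulr1 => -[y gy sE].
by exists s; split=> //; rewrite -sE mulrAC mulVf ?mul1r.
Qed.

Lemma boole_closure : boole_regular A star -> gcd_domain D.
Proof.
move=> boole; split=> // a b Da Db a0 b0.
pose g (i : 'I_2) := if i == ord0 then a else b.
have [x x0 [Dgx dgx]] := boole_regular_fg (i0 := ord0) boole (a0 : g ord0 != 0).
have mI : submodule D (span D g) by apply: span_submodule.
(* The element [x] lies in the closure of every [D]-module containing [a] and [b]. With [D] this
   puts [x] in [D]; with [h D], which is closed, it shows that a common divisor [h] divides [x]. *)
have gen_local S : submodule D S -> S a -> S b -> dot S x.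
  move=> mS Sa Sb; apply/(dotP _ mS) => M maxM.
  apply: at_locS (iffLR (dotP _ mI) dgx M maxM).
  by apply: (span_min mS) => i; rewrite /g; case: (_ == _).
exists x; first by rewrite -dot_closure; apply: gen_local.
split.
- by exists (a / x); [apply: (Dgx ord0) | rewrite divfK].
- by exists (b / x); [apply: (Dgx ord_max) | rewrite divfK].
move=> h Dh [c Dc ac] [d Dd bd].
have h0 : h != 0 by apply: contra_neq a0 => h0; rewrite ac h0 mulr0.
have : dot (scale h D) x.
  apply: gen_local; first exact: scale_submodule.
    by exists c; rewrite // mulrC.
  by exists d; rewrite // mulrC.
rewrite (star_scale sD) ?dot_closure //; last exact: ideal_self.
by move=> [e De <-]; exists e; rewrite // mulrC.
Qed.

End Closure.
End Modules.

(** * The base ring inside its fraction field *)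

Lemma base_ring_subring (R : idomainType) : subring (base_ring R).
Proof.
split; first by exists 1; rewrite // rmorph1.
- by move=> _ _ [x _ <-] [y _ <-]; exists (x - y); rewrite // rmorphB.
- by move=> _ _ [x _ <-] [y _ <-]; exists (x * y); rewrite // rmorphM.
Qed.

Lemma base_ring_has_fractions (R : idomainType) :
  has_fractions (base_ring R).
Proof.
elim/quotW => q; have d0 := denom_ratioP q.
exists (tofrac q.1), (tofrac q.2); split; [by exists q.1|by exists q.2| |].
  by rewrite tofrac_eq0.
apply: (canRL (mulfK _)); first by rewrite tofrac_eq0.
(* On representatives the equality of fractions becomes a cross-multiplication in [R]. *)
rewrite !piE; apply/eqmodP; rewrite /= FracField.equivfE.
by rewrite /FracField.mulf !numden_Ratio ?mulf_neq0 ?oner_neq0 // !mulr1 mulrC.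
Qed.

Theorem theorem4p3 (R : idomainType)
    (star : set {fraction R} -> set {fraction R})
    (star_op : star_operation (base_ring R) star)
    (star_ft : finite_type_op (base_ring R) star)
    (star_sp : spectral_op (base_ring R) star)
    (star_eq_tilde :
       eq_on_ideals (base_ring R) star (star_tilde (base_ring R) star)) :
  let D := star_integral_closure (base_ring R) star in
  let dot_star := star_tilde (base_ring R) star in
  (clifford_regular (base_ring R) star ->
     [/\ PstarMD D dot_star,
         eq_on_ideals D dot_star (w_op D)
       & eq_on_ideals D (w_op D) (t_op D)])
  /\ (boole_regular (base_ring R) star -> gcd_domain D).
Proof.

have rR := base_ring_subring R; have fR := @base_ring_has_fractions R.
split; first exact: clifford_closure.
exact: boole_closure.
Qed.
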